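(* There is an absolute constant $c>0$ such that for every integer $n\ge 8$ and every power $q$ of an odd prime there exists a radius spherical Kakeya set $\mathcal{K}\subset\mathbb{F}_q^n$ with $$\left|\,|\mathcal{K}|-\left(\tfrac{1}{2}q^n + \tfrac{1}{2}q^{n-1} -q^{n-2}\right)\right|\le c\,q^{n-3}.$$
   Context: $\mathbb{F}_q$ is the finite field with $q$ elements and $\mathbb{F}_q^*=\mathbb{F}_q\setminus\{0\}$. For $\underline{x}=(x_1,\ldots,x_n)\in\mathbb{F}_q^n$ put $\|\underline{x}\|=x_1^2+\cdots+x_n^2\in\mathbb{F}_q$. The sphere of radius $r\in\mathbb{F}_q^*$ and center $\underline{a}\in\mathbb{F}_q^n$ is $\mathcal{S}_r(\underline{a})=\{\underline{x}\in\mathbb{F}_q^n : \|\underline{x}-\underline{a}\|=r\}$. A radius spherical Kakeya set in $\mathbb{F}_q^n$ is a subset $\mathcal{K}\subset\mathbb{F}_q^n$ such that for each $r\in\mathbb{F}_q^*$ there is $\underline{a}\in\mathbb{F}_q^n$ with $\mathcal{S}_r(\underline{a})\subset\mathcal{K}$. *)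

(* Defs.v *)
From HB Require Import structures.
From mathcomp Require Import all_boot all_order all_algebra.
From mathcomp Require Import reals.

Set Implicit Arguments.
Unset Strict Implicit.
Unset Printing Implicit Defensive.

Import Order.TTheory GRing.Theory Num.Theory.
Local Open Scope ring_scope.

(* The "norm" is the quadratic form x_1^2 + ... + x_n^2, with values in F
   and without a square root. *)
Definition qnorm (F : finFieldType) (n : nat) (x : 'rV[F]_n) : F :=
  \sum_(i < n) x ord0 i ^+ 2.

Definition sphere (F : finFieldType) (n : nat) (r : F) (a : 'rV[F]_n) :
  {set 'rV[F]_n} := [set x | qnorm (x - a) == r].

Definition radius_spherical_Kakeya (F : finFieldType) (n : nat)
  (K : {set 'rV[F]_n}) : Prop :=
  forall r : F, r != 0 -> exists a : 'rV[F]_n, sphere r a \subset K.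

(* Main.v *)
Require Import Defs.
From HB Require Import structures.
From mathcomp Require Import all_boot all_order all_algebra all_field.
From mathcomp Require Import reals ring lra zify.

Set Implicit Arguments.
Unset Strict Implicit.
Unset Printing Implicit Defensive.

Import Order.TTheory GRing.Theory Num.Theory.
Local Open Scope ring_scope.

(* Fix an isotropic vector v and center the sphere of radius r at v / (2r): it
   is then {x : r^2 - |x| r + v.x = 0}.  In the plane of the pairs (|x|, v.x)
   these are q - 1 lines tangent to a conic, no three of them concurrent, so
   that their union is as small as possible: (q - 1)(q + 2)/2 points, of which
   (q - 1)q/2 have v.x <> 0.  Each such point (y, z) with z <> 0 has exactly
   q^(n-2) preimages, because |x + s v| = |x| + 2 s (v.x).  On the hyperplane
   v.x = 0 the union is {|x| <> 0}, hence everything reduces to estimating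
   the number of x with v.x = 0 and |x| = 0. *)

Section FiniteFieldCounting.
Variables (F : finFieldType) (n : nat).
Local Notation V := 'rV[F]_n.
Local Notation q := #|F|.
Implicit Types (A B : {set V}) (u v w x : V).

(** * The bilinear form of [qnorm] *)

Definition dot u v : F := \sum_(i < n) u ord0 i * v ord0 i.

Lemma dotC u v : dot u v = dot v u.
Proof. by apply: eq_bigr => i _; rewrite mulrC. Qed.

Lemma dotDr u v w : dot u (v + w) = dot u v + dot u w.
Proof. by rewrite -big_split; apply: eq_bigr => i _; rewrite mxE mulrDr. Qed.

Lemma dotZr u a v : dot u (a *: v) = a * dot u v.
Proof. by rewrite mulr_sumr; apply: eq_bigr => i _; rewrite mxE mulrCA. Qed.

Lemma dotDl u v w : dot (v + w) u = dot v u + dot w u.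
Proof. by rewrite dotC dotDr !(dotC u). Qed.

Lemma dotZl u a v : dot (a *: v) u = a * dot v u.
Proof. by rewrite dotC dotZr (dotC u). Qed.

Lemma dot_delta (i j : 'I_n) :
  dot (delta_mx ord0 i) (delta_mx ord0 j) = (i == j)%:R.
Proof.
rewrite /dot (bigD1 i) //= big1 => [|k /negPf ki]; last by rewrite !mxE ki mul0r.
by rewrite !mxE !eqxx mul1r addr0.
Qed.

Lemma qnormE x : qnorm x = dot x x.
Proof. by apply: eq_bigr => i _; rewrite expr2. Qed.

Lemma qnorm_translate v x s :
  qnorm v = 0 -> qnorm (x + s *: v) = qnorm x + s * (2 * dot v x).
Proof.
rewrite !qnormE => v0; rewrite dotDl !dotDr !dotZl !dotZr v0 (dotC x v).
by ring.
Qed.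

(** * Fibre counts along translation directions *)

Definition translation_stable A w := forall x s, x \in A -> x + s *: w \in A.

Lemma translation_stableT w : translation_stable setT w.
Proof. by move=> x s _; rewrite inE. Qed.

Lemma translation_stable_hyperplane A v w z :
  translation_stable A w -> dot v w = 0 ->
  translation_stable [set x in A | dot v x == z] w.
Proof.
move=> Aw vw x s; rewrite !inE => /andP[xA xz].
by rewrite Aw // dotDr dotZr vw mulr0 addr0.
Qed.

(** Translation by [(t' - t) / c *: w] injects the fibre over [t] into the one over [t'], so all [q]
    fibres have equal size. Only stability of [A] is asked, so that the count can be repeated inside
    nested hyperplane sections. *)
Lemma card_translation_fiber A (f : V -> F) w c k y :
  c != 0 -> translation_stable A w ->
  (forall x s, x \in A -> f (x + s *: w) = f x + s * c) ->
  #|A| = (q ^ k.+1)%N -> #|[set x in A | f x == y]| = (q ^ k)%N.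
Proof.
move=> c0 Aw fw cA.
have le_fiber t t' :
    (#|[set x in A | f x == t]| <= #|[set x in A | f x == t']|)%N.
  rewrite -(card_imset _ (addIr ((t' - t) / c *: w))); apply: subset_leq_card.
  apply/subsetP => _ /imsetP[x + ->]; rewrite !inE => /andP[xA /eqP xt].
  by rewrite Aw // fw // divfK // xt addrC subrK eqxx.
have q0 : (0 < q)%N by apply/card_gt0P; exists 0.
apply/eqP; rewrite -(eqn_pmul2l q0) -expnS -cA; apply/eqP.
rewrite -[RHS]sum1_card (partition_big f xpredT) //=.
rewrite -[LHS]sum_nat_const; apply: eq_bigr => t _.
rewrite sum1dep_card; apply/eqP; rewrite eqn_leq.
by rewrite !le_fiber.
Qed.

Lemma card_hyperplane A v w z k :
  translation_stable A w -> dot v w = 1 -> #|A| = (q ^ k.+1)%N ->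
  #|[set x in A | dot v x == z]| = (q ^ k)%N.
Proof.
move=> Aw vw; apply: (card_translation_fiber _ (oner_neq0 F) Aw).
by move=> x s _; rewrite dotDr dotZr vw.
Qed.

Hypothesis two_neq0 : 2 != 0 :> F.

(* On each line in the isotropic direction v lying in the affine hyperplane
   v.x = z <> 0, the form is affine and nonconstant. *)
Lemma card_hyperplane_qnorm A v w z y k :
  translation_stable A v -> translation_stable A w ->
  qnorm v = 0 -> dot v w = 1 -> z != 0 -> #|A| = (q ^ k.+2)%N ->
  #|[set x in A | (dot v x == z) && (qnorm x == y)]| = (q ^ k)%N.
Proof.
move=> Av Aw v0 vw z0 cA.
have vv : dot v v = 0 by rewrite -qnormE.
have cAz := card_hyperplane z Aw vw cA.
have Azv := translation_stable_hyperplane (z := z) Av vv.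
have c0 : 2 * z != 0 by rewrite mulf_neq0.
rewrite -(card_translation_fiber (f := @qnorm F n) y c0 Azv _ cAz) => [|x s].
  by apply: eq_card => x; rewrite !inE andbA.
by rewrite inE => /andP[_ /eqP <-]; rewrite qnorm_translate.
Qed.

(** Each slice [dot v x = z] with [z != 0] contributes [q ^ k]. The slice [z = 0] is kept whole,
    ready to be split again along another isotropic vector. *)
Lemma card_qnorm0_split A v w k :
  translation_stable A v -> translation_stable A w ->
  qnorm v = 0 -> dot v w = 1 -> #|A| = (q ^ k.+2)%N ->
  #|[set x in A | qnorm x == 0]| =
  (q.-1 * q ^ k + #|[set x in [set x in A | dot v x == 0%R] | qnorm x == 0%R]|)%N.
Proof.
move=> Av Aw v0 vw cA.
rewrite -sum1_card (partition_big (dot v) xpredT) //= (bigD1 0) //= addnC.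
congr (_ + _)%N; last first.
  rewrite sum1dep_card; apply: eq_card => x; rewrite !inE.
  by rewrite andbAC.
rewrite -(cardC1 (0 : F)) -sum_nat_const; apply: eq_big => [z|z z0].
  by rewrite !inE.
rewrite sum1dep_card -(card_hyperplane_qnorm 0 Av Aw v0 vw z0 cA).
by apply: eq_card => x; rewrite !inE -andbA [X in _ && X]andbC.
Qed.

(** * Pairs of roots and the union of spheres *)

(* The left side counts ordered pairs of roots of r^2 - y r + z, a double root
   with weight two; z <> 0 makes all roots nonzero. *)
Lemma card_pair_sum_prod (y z : F) : z != 0 ->
  (\sum_(rs : F * F | ((rs.1 + rs.2)%R == y) && ((rs.1 * rs.2)%R == z))
     (1 + (rs.1 == rs.2)) =
   2 * [exists r, (r != 0%R) && ((r ^+ 2 - y * r + z)%R == 0%R)])%N.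
Proof.
move=> z0; case: existsP => [[r /andP[r0 /eqP rz]]|nr]; last first.
  rewrite big1 // => -[r s] /= /andP[/eqP rsy /eqP rsz]; case: nr; exists r.
  move: z0; rewrite -rsz mulf_eq0 negb_or => /andP[-> _] /=.
  by rewrite -rsy; apply/eqP; ring.
have zE : z = r * (y - r) by rewrite -[z]subr0 -rz; ring.
rewrite (bigD1 (r, y - r)) /=; last by rewrite -zE addrC subrK !eqxx.
(* By Vieta the other root is [y - r]. A double root leaves one pair of weight two; distinct roots
   give two pairs of weight one. *)
have [ryr|rNyr] := eqVneq r (y - r).
  rewrite big1 // => -[s t] /= /andP[/andP[/eqP sty /eqP stz]].
  have tE : t = y - s by rewrite -sty addrC addKr.
  have yE : y = r + r by rewrite {1}ryr addrNK.
  have /eqP : (s - r) ^+ 2 = 0.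
    have : s * (y - s) - r * (y - r) = 0 by rewrite -tE stz zE subrr.
    by rewrite yE => h; rewrite -oppr0 -h; ring.
  rewrite expf_eq0 /= subr_eq0 => /eqP sr.
  by rewrite tE sr eqxx.
rewrite (bigD1 (y - r, r)) /=; last first.
  by rewrite subrK mulrC -zE !eqxx /= xpair_eqE negb_and eq_sym rNyr.
rewrite big1 => [|[s t] /= /andP[/andP[/andP[/eqP sty /eqP stz] n1] n2]].
  by rewrite eq_sym (negPf rNyr).
have tE : t = y - s by rewrite -sty addrC addKr.
have /eqP : (s - r) * (s - (y - r)) = 0.
  have : s * (y - s) - r * (y - r) = 0 by rewrite -tE stz zE subrr.
  by move=> h; rewrite -oppr0 -h; ring.
rewrite mulf_eq0 !subr_eq0 => /orP[] /eqP sE.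
  by move: n1; rewrite tE sE eqxx.
by move: n2; rewrite tE sE subKr eqxx.
Qed.

Definition hyperbolic_union v :=
  [set x : V | [exists r, (r != 0) && (r ^+ 2 - qnorm x * r + dot v x == 0)]].

Lemma hyperbolic_union_Kakeya v :
  qnorm v = 0 -> radius_spherical_Kakeya (hyperbolic_union v).
Proof.
move=> v0 r r0; exists ((2 * r)^-1 *: v); apply/subsetP => x; rewrite !inE.
rewrite -scaleNr qnorm_translate // => /eqP h.
apply/existsP; exists r; rewrite r0 /=; apply/eqP.
(* As [v] is isotropic, the sphere equation reads [qnorm x - dot v x / r = r]. *)
have -> : qnorm x = r + dot v x / r.
  by rewrite -{1}h; field; rewrite r0 two_neq0.
by field.
Qed.

(** Double counting of points against ordered pairs of nonzero roots: a pair [(r, s)] fixes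
    [qnorm x = r + s] and [dot v x = r * s], hence is met by [q ^ k] points. *)
Lemma card_hyperbolic_union_off_hyperplane v w k :
  n = k.+2 -> qnorm v = 0 -> dot v w = 1 ->
  (2 * #|[set x in hyperbolic_union v | dot v x != 0%R]| = q.-1 * q * q ^ k)%N.
Proof.
move=> nE v0 vw.
have cT : #|[set: V]| = (q ^ k.+2)%N by rewrite cardsT card_mx mul1n nE.
have cN z y (z0 : z != 0) := card_hyperplane_qnorm y
  (translation_stableT v) (translation_stableT w) v0 vw z0 cT.
transitivity (\sum_(x : V | dot v x != 0%R)
    \sum_(rs : F * F | ((rs.1 + rs.2)%R == qnorm x) && ((rs.1 * rs.2)%R == dot v x))
       (1 + (rs.1 == rs.2)))%N.
  rewrite -sum1_card big_distrr /= big_mkcond [RHS]big_mkcond.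
  apply: eq_bigr => x _; rewrite !inE andbC.
  have [//|vx] := eqVneq (dot v x) 0.
  by rewrite card_pair_sum_prod //=; case: ifP.
rewrite (exchange_big_dep (fun rs : F * F => rs.1 * rs.2 != 0)) /=; last first.
  by move=> x rs vx /andP[_ /eqP ->].
transitivity (\sum_(rs : F * F | (rs.1 * rs.2)%R != 0%R)
    (1 + (rs.1 == rs.2)) * q ^ k)%N.
  apply: eq_bigr => rs rs0; rewrite sum_nat_cond_const mulnC; congr (_ * _)%N.
  rewrite -(cN _ (rs.1 + rs.2) rs0); apply: eq_card => x; rewrite !inE /=.
  rewrite [rs.1 * rs.2 == _]eq_sym [rs.1 + rs.2 == _]eq_sym.
  have [->|_] := eqVneq (dot v x) (rs.1 * rs.2); last by rewrite !andbF.
  by rewrite rs0 andbT.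
rewrite -big_distrl /=; congr (_ * _)%N.
transitivity (\sum_(r : F | r != 0%R) \sum_(s : F | s != 0%R) (1 + (r == s)))%N.
  rewrite pair_big; apply: eq_bigl => -[r s] /=.
  by rewrite mulf_eq0 negb_or.
have cC1 : #|[pred r : F | r != 0]| = q.-1.
  by rewrite -(cardC1 (0 : F)); apply: eq_card => r; rewrite !inE.
rewrite -{1}cC1 -sum_nat_const; apply: eq_bigr => r r0.
(* For fixed [r] the [q - 1] values of [s] weigh one each and the diagonal adds one: [q] in all. *)
rewrite big_split /= sum1_card cC1 (bigD1 r) //= eqxx big1; last first.
  by move=> s /andP[_]; rewrite eq_sym => /negPf ->.
by rewrite addn0 addn1 prednK //; apply/card_gt0P; exists 0.
Qed.

(** When [dot v x = 0] the equation is [r * (r - qnorm x) = 0], whose only possible nonzero root is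
    [qnorm x]. *)
Lemma card_hyperbolic_union_hyperplane v w k :
  n = k.+1 -> dot v w = 1 ->
  (#|[set x in hyperbolic_union v | dot v x == 0%R]| +
   #|[set x in [set x in [set: V] | dot v x == 0%R] | qnorm x == 0%R]|
     = q ^ k)%N.
Proof.
move=> nE vw.
have cT : #|[set: V]| = (q ^ k.+1)%N by rewrite cardsT card_mx mul1n nE.
have <- := card_hyperplane 0 (translation_stableT w) vw cT.
rewrite -[in RHS](cardsID [set x | qnorm x == 0]) addnC.
congr (_ + _)%N; first by apply: eq_card => x; rewrite !inE.
apply: eq_card => x; rewrite !inE /=.
have [vx|_] := eqVneq; last by rewrite ?andbF.
rewrite vx !andbT; apply/existsP/idP => [[r /andP[r0 /eqP rx]]|x0].
  apply: contra_neq r0 => x0; move: rx; rewrite x0 mul0r subr0 addr0.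
  by move/eqP; rewrite expf_eq0 => /eqP.
by exists (qnorm x); rewrite x0 expr2 addr0 subrr eqxx.
Qed.

End FiniteFieldCounting.

(** * Isotropic vectors over a finite field *)

(** Pigeonhole: more than half of the elements are squares, so the squares meet their image under
    [s -> - 1 - s]. *)
Lemma sum_two_squares_eqN1 (F : finFieldType) :
  2 != 0 :> F -> exists a b : F, a ^+ 2 + b ^+ 2 + 1 = 0.
Proof.
move=> two0; pose S := [set a ^+ 2 | a : F].
have cS : (#|F| < 2 * #|S|)%N.
  rewrite -[ltnLHS]sum1_card.
  rewrite (partition_big (fun a : F => a ^+ 2) (mem S)) /=; last first.
    by move=> a _; apply: imset_f.
  have S0 : 0 \in S by apply/imsetP; exists 0; rewrite ?expr0n.
  (* Fibres of squaring have at most two elements, and the fibre over 0 only one, which makes the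
     inequality strict. *)
  rewrite mulnC -sum_nat_const (bigD1 0) //= [ltnRHS](bigD1 0) //=.
  rewrite -addSn; apply: leq_add.
    by rewrite (big_pred1 0) // => a; rewrite expf_eq0.
  apply: leq_sum => _ /andP[/imsetP[a _ ->] _].
  rewrite sum1dep_card; apply: leq_trans (_ : #|[set a; - a]| <= 2)%N; last first.
    by rewrite cards2; case: (_ != _).
  by apply: subset_leq_card; apply/subsetP => b; rewrite !inE eqf_sqr.
pose T := [set - 1 - s | s in S].
have cT : #|T| = #|S| by rewrite card_imset // => s t /addrI /oppr_inj.
have : S :&: T != set0.
  have cU : (#|S :|: T| <= #|F|)%N := max_card _.
  by rewrite -card_gt0; move: (cardsUI S T) cU cS; rewrite cT; lia.
case/set0Pn => _ /setIP[/imsetP[a _ ->]] /imsetP[_ /imsetP[b _ ->]] ab.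
by exists a, b; rewrite ab; ring.
Qed.

Lemma isotropic_triple (F : finFieldType) n :
  2 != 0 :> F -> (7 <= n)%N ->
  exists v1 v2 v3 w1 w2 w3 : 'rV[F]_n,
    [/\ qnorm v1 = 0, qnorm v2 = 0 & qnorm v3 = 0] /\
    [/\ dot v1 v2 = 0, dot v1 v3 = 0 & dot v2 v3 = 0] /\
    [/\ dot v1 w1 = 1, dot v2 w2 = 1 & dot v3 w3 = 1] /\
    [/\ dot v1 w2 = 0, dot v1 w3 = 0 & dot v2 w3 = 0].
Proof.
move=> two0 n7; have [a [b ab]] := sum_two_squares_eqN1 two0.
pose E (i : 'I_7) : 'rV[F]_n := delta_mx ord0 (widen_ord n7 i).
have EE i j : dot (E i) (E j) = (i == j)%:R by rewrite dot_delta.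
pose e i := E (inord i).
have ee i j : (i < 7)%N -> (j < 7)%N -> dot (e i) (e j) = (i == j)%:R.
  by move=> i7 j7; rewrite EE -val_eqE /= !inordK.
(* Isotropy is [a ^+ 2 + b ^+ 2 + 1 = 0]. The first two vectors are orthogonal because [(- b, a)] is
   [(a, b)] turned by a right angle; the third uses disjoint coordinates. The [w] are a triangular
   dual family. *)
exists (a *: e 0 + b *: e 1 + e 2), (- b *: e 0 + a *: e 1 + e 3).
exists (a *: e 4 + b *: e 5 + e 6), (e 2), (e 3), (e 6).
rewrite !qnormE !(dotDl, dotDr, dotZl, dotZr) !ee //=.
by split; [|split; [|split]]; split; first [ring | rewrite -[RHS]ab; ring].
Qed.

(* Three mutually orthogonal independent isotropic vectors peel off the two
   leading terms of the count, leaving a trivially bounded remainder. *)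
Lemma card_hyperplane_qnorm0 (F : finFieldType) (k : nat)
    (v1 v2 v3 w1 w2 w3 : 'rV[F]_k.+4) :
  2 != 0 :> F ->
  qnorm v1 = 0 -> qnorm v2 = 0 -> qnorm v3 = 0 ->
  dot v1 v2 = 0 -> dot v1 v3 = 0 -> dot v2 v3 = 0 ->
  dot v1 w1 = 1 -> dot v2 w2 = 1 -> dot v3 w3 = 1 ->
  dot v1 w2 = 0 -> dot v1 w3 = 0 -> dot v2 w3 = 0 ->
  exists2 m, (m <= #|F| ^ k.+1)%N &
    #|[set x in [set x in [set: 'rV[F]_k.+4] | dot v1 x == 0%R] | qnorm x == 0%R]|
    = (#|F|.-1 * #|F| ^ k.+1 + (#|F|.-1 * #|F| ^ k + m))%N.
Proof.
move=> two0 q1 q2 q3 d12 d13 d23 e1 e2 e3 f12 f13 f23.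
set A := [set x in [set: _] | _].
have cA : #|A| = (#|F| ^ k.+3)%N.
  apply: (card_hyperplane _ (translation_stableT w1) e1).
  by rewrite cardsT card_mx mul1n.
have Ast w : dot v1 w = 0 -> translation_stable A w.
  exact/translation_stable_hyperplane/translation_stableT.
have Bst w : dot v1 w = 0 -> dot v2 w = 0 ->
    translation_stable [set x in A | dot v2 x == 0] w.
  by move=> ? ?; apply/translation_stable_hyperplane => //; apply: Ast.
have cB := card_hyperplane 0 (Ast _ f12) e2 cA.
have cC := card_hyperplane 0 (Bst _ f13 f23) e3 cB.
rewrite (card_qnorm0_split two0 (Ast _ d12) (Ast _ f12) q2 e2 cA).
rewrite (card_qnorm0_split two0 (Bst _ d13 d23) (Bst _ f13 f23) q3 e3 cB).
(* Here [m] counts the zeros of the form orthogonal to all three vectors, at most the size of that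
   subspace of codimension three. *)
eexists; last by [].
rewrite -cC; apply: subset_leq_card; apply/subsetP => x.
by rewrite [in X in X -> _]inE => /andP[].
Qed.

Theorem mainTheorem2 (R : realType) :
  exists c : R, 0 < c /\
    forall (n : nat) (p e : nat) (F : finFieldType),
      (8 <= n)%N -> prime p -> odd p -> (0 < e)%N -> #|F| = (p ^ e)%N ->
      let q : R := #|F|%:R in
      exists K : {set 'rV[F]_n},
        radius_spherical_Kakeya K /\
        `| #|K|%:R - (2^-1 * q ^+ n + 2^-1 * q ^+ (n - 1) - q ^+ (n - 2)) |
          <= c * q ^+ (n - 3).
Proof.
(* The constant is 1 because, with [n = k + 4], the error is [q ^+ k - m] where
   [0 <= m <= q ^+ k.+1]. *)
exists 1; split=> [|n p e F n8 p_pr p_odd e0 cF q]; first exact: ltr01.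
have two0 : 2 != 0 :> F.
  have chF : p \in [pchar F] by apply: card_finPcharP cF p_pr.
  rewrite -(dvdn_pcharf chF) dvdn_prime2 //.
  by apply: contraTneq p_odd => ->.
have [v1 [v2 [v3 [w1 [w2 [w3 h]]]]]] := isotropic_triple two0 (ltnW n8).
have [k nE] : exists k, n = k.+4 by exists (n - 4)%N; lia.
move: n8 v1 v2 v3 w1 w2 w3 h; rewrite nE => _ v1 v2 v3 w1 w2 w3.
case=> [[q1 q2 q3] [[d12 d13 d23] [[e1 e2 e3] [f12 f13 f23]]]].
exists (hyperbolic_union v1); split; first exact: hyperbolic_union_Kakeya.
have [m m_le cN] := card_hyperplane_qnorm0 two0 q1 q2 q3 d12 d13 d23
  e1 e2 e3 f12 f13 f23.
have c1 := card_hyperbolic_union_off_hyperplane two0 (erefl _) q1 e1.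
have c0 := card_hyperbolic_union_hyperplane (erefl _) e1.
have cK : #|hyperbolic_union v1| =
    (#|[set x in hyperbolic_union v1 | dot v1 x != 0%R]| +
     #|[set x in hyperbolic_union v1 | dot v1 x == 0%R]|)%N.
  rewrite -(cardsID [set x | dot v1 x == 0%R] (hyperbolic_union v1)) addnC.
  by congr (_ + _)%N; apply: eq_card => x; rewrite !in_set [RHS]andbC // andbC.
have q_gt0 : (0 < #|F|)%N by apply/card_gt0P; exists 0.
have qE : #|F|.-1%:R = q - 1 by rewrite -subn1 natrB.
move: c0 c1; rewrite {}cN {}cK.
set K1 := #|[set _ in _ | _ != _]|; set K0 := #|[set _ in _ | _ == _]|.
move=> /(congr1 (fun m => m%:R : R)) + /(congr1 (fun m => m%:R : R)).
have := m_le; rewrite -(ler_nat R).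
rewrite !(natrD, natrM, natrX) qE -/q => mR c0 c1.
rewrite !subSS !subn0 !mul1r.
have q1R : 1 <= q by rewrite ler1n.
have m0 : 0 <= m%:R :> R by rewrite ler0n.
have Q0 : 0 <= q ^+ k by rewrite exprn_ge0 // ler0n.
move: mR c0 c1; rewrite !exprS; set Q := q ^+ k in Q0 *.
move=> mR c0 c1.
have -> : K1%:R + K0%:R - (2^-1 * (q * (q * (q * (q * Q)))) +
    2^-1 * (q * (q * (q * Q))) - q * (q * Q)) = Q - m%:R.
  by lra.
rewrite ler_norml; nra.
Qed.
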